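(* Let $d,m\in\mathbb{N}$, and let $\boldsymbol{\gamma}:\mathbb{R}^d\times\mathbb{R}^d\to\mathbb{R}^{m\times m}$ be a conditionally negative definite kernel. Let $\mu$ be a measure on $(0,\infty)$, let $\boldsymbol{\Sigma}_i:\mathbb{R}^d\to\mathbb{R}^{d\times d}$, $i=1,\dots,m$, be functions whose values are symmetric and positive definite matrices, and denote $\boldsymbol{\Sigma}_{ij}(\boldsymbol{x},\boldsymbol{y}):=(\boldsymbol{\Sigma}_i(\boldsymbol{x})+\boldsymbol{\Sigma}_j(\boldsymbol{y}))/2$, $i,j=1,\dots,m$. Then the kernel $\boldsymbol{C}:\mathbb{R}^d\times\mathbb{R}^d\to\mathbb{R}^{m\times m}$ defined by $$C_{ij}(\boldsymbol{x},\boldsymbol{y})=\frac{|\boldsymbol{\Sigma}_i(\boldsymbol{x})|^{1/4}|\boldsymbol{\Sigma}_j(\boldsymbol{y})|^{1/4}}{|\boldsymbol{\Sigma}_{ij}(\boldsymbol{x},\boldsymbol{y})|^{1/2}}\int_0^\infty\exp\left(-t\left((\boldsymbol{x}-\boldsymbol{y})^\top\boldsymbol{\Sigma}_{ij}(\boldsymbol{x},\boldsymbol{y})^{-1}(\boldsymbol{x}-\boldsymbol{y})+\gamma_{ij}(\boldsymbol{x},\boldsymbol{y})\right)\right)d\mu(t),$$ $\boldsymbol{x},\boldsymbol{y}\in\mathbb{R}^d$, $i,j=1,\dots,m$, is positive definite, provided the integral exists (for all $\boldsymbol{x},\boldsymbol{y},i,j$).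
   Context: $|\cdot|$ applied to a matrix denotes its determinant. A matrix-valued kernel $\boldsymbol{C}:\mathbb{R}^d\times\mathbb{R}^d\to\mathbb{R}^{m\times m}$ with $C_{ij}(\boldsymbol{x},\boldsymbol{y})=C_{ji}(\boldsymbol{y},\boldsymbol{x})$ is called positive definite if $\sum_{i,j=1}^n\boldsymbol{a}_i^\top\boldsymbol{C}(\boldsymbol{x}_i,\boldsymbol{x}_j)\boldsymbol{a}_j\ge0$ for all $n\in\mathbb{N}$, $\boldsymbol{x}_1,\dots,\boldsymbol{x}_n\in\mathbb{R}^d$, $\boldsymbol{a}_1,\dots,\boldsymbol{a}_n\in\mathbb{R}^m$. A matrix-valued kernel $\boldsymbol{\gamma}:\mathbb{R}^d\times\mathbb{R}^d\to\mathbb{R}^{m\times m}$ is conditionally negative definite if $\gamma_{ij}(\boldsymbol{x},\boldsymbol{y})=\gamma_{ji}(\boldsymbol{y},\boldsymbol{x})$ for all $\boldsymbol{x},\boldsymbol{y},i,j$, and $\sum_{i,j=1}^n\boldsymbol{a}_i^\top\boldsymbol{\gamma}(\boldsymbol{x}_i,\boldsymbol{x}_j)\boldsymbol{a}_j\le0$ for all $n\in\mathbb{N}$, $\boldsymbol{x}_i\in\mathbb{R}^d$, $\boldsymbol{a}_i\in\mathbb{R}^m$ such that $\boldsymbol{1}_m^\top\sum_{k=1}^n\boldsymbol{a}_k=0$, where $\boldsymbol{1}_m=(1,\dots,1)^\top\in\mathbb{R}^m$. *)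

(* Defs.v *)
From HB Require Import structures.
From mathcomp Require Import all_boot all_order all_algebra.
From mathcomp Require Import all_classical all_reals all_analysis.
Set Implicit Arguments.
Unset Strict Implicit.
Unset Printing Implicit Defensive.
Import Order.TTheory GRing.Theory Num.Theory.
Import numFieldNormedType.Exports.
Local Open Scope classical_set_scope.
Local Open Scope ring_scope.

Definition sym_posdef_mx (R : realType) (d : nat) (S : 'M[R]_d) : Prop :=
  S \is symmetricmx /\ forall v : 'cV[R]_d, v != 0 -> 0 < (v^T *m S *m v) 0 0.

Definition mxkernel (R : realType) (d m : nat) : Type :=
  'cV[R]_d -> 'cV[R]_d -> 'M[R]_m.

Definition kernel_sym (R : realType) (d m : nat) (K : mxkernel R d m) : Prop :=
  forall (x y : 'cV[R]_d) (i j : 'I_m), K x y i j = K y x j i.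

Definition kernel_form (R : realType) (d m : nat) (K : mxkernel R d m)
    (n : nat) (x : 'I_n -> 'cV[R]_d) (a : 'I_n -> 'cV[R]_m) : R :=
  \sum_(i < n) \sum_(j < n) ((a i)^T *m K (x i) (x j) *m a j) 0 0.

Definition kernel_posdef (R : realType) (d m : nat) (K : mxkernel R d m) :
    Prop :=
  kernel_sym K /\
  forall (n : nat) (x : 'I_n -> 'cV[R]_d) (a : 'I_n -> 'cV[R]_m),
    0 <= kernel_form K x a.

(* A single scalar constraint: the entries of all the [a k] together sum to 0;
   the individual coordinates of [\sum_k a k] need not vanish. *)
Definition kernel_cnegdef (R : realType) (d m : nat) (K : mxkernel R d m) :
    Prop :=
  kernel_sym K /\
  forall (n : nat) (x : 'I_n -> 'cV[R]_d) (a : 'I_n -> 'cV[R]_m),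
    (const_mx 1 : 'cV[R]_m)^T *m (\sum_(k < n) a k) = 0 ->
    kernel_form K x a <= 0.

Definition Sigma_avg (R : realType) (d m : nat)
    (Sigma : 'I_m -> 'cV[R]_d -> 'M[R]_d) (i j : 'I_m) (x y : 'cV[R]_d) :
    'M[R]_d :=
  2^-1 *: (Sigma i x + Sigma j y).

Definition mixture_integrand (R : realType) (d m : nat)
    (gamma : mxkernel R d m) (Sigma : 'I_m -> 'cV[R]_d -> 'M[R]_d)
    (i j : 'I_m) (x y : 'cV[R]_d) (t : R) : R :=
  expR (- (t * (((x - y)^T *m invmx (Sigma_avg Sigma i j x y) *m (x - y)) 0 0
                + gamma x y i j))).

(* A measure on (0, +oo) is given as a Borel measure [mu] on the line, of which
   only the restriction to (0, +oo) enters the integral. *)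
Definition mixture_kernel (R : realType) (d m : nat)
    (gamma : mxkernel R d m) (Sigma : 'I_m -> 'cV[R]_d -> 'M[R]_d)
    (mu : {measure set (measurableTypeR R) -> \bar R}) : mxkernel R d m :=
  fun x y => \matrix_(i < m, j < m)
    ((\det (Sigma i x)) `^ (1 / 4) * (\det (Sigma j y)) `^ (1 / 4)
       / (\det (Sigma_avg Sigma i j x y)) `^ (1 / 2)
     * \int[mu]_(t in `]0, +oo[) mixture_integrand gamma Sigma i j x y t).

(* Main.v *)
(* For fixed t > 0 the integrand, with its determinantal prefactor, is a Schur
   product of two kernels on the finite index set of pairs (point, component).
   The first, exp(-t gamma), is positive definite by Schoenberg: relative to a
   base point r it is a rescaling of exp(phi) with phi = sum_v v v^T a Gram matrix,
   and each factor exp(v_p v_q) is a rescaled Gaussian integral.  The second is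
   the normalised L^2 inner product of two Gaussian densities with
   precision matrices proportional to the inverses of Sigma_i(x) and Sigma_j(y).
   Integrating in t preserves positive definiteness. *)
Require Import Defs.
From HB Require Import structures.
From mathcomp Require Import all_boot all_order all_algebra.
From mathcomp Require Import all_classical all_reals all_analysis.
From mathcomp Require Import ring lra.
Set Implicit Arguments.
Unset Strict Implicit.
Unset Printing Implicit Defensive.
Import Order.TTheory GRing.Theory Num.Theory.
Import numFieldNormedType.Exports.
Local Open Scope classical_set_scope.
Local Open Scope ring_scope.

(** * Positive semidefinite kernels on a finite index type, Gram decomposition and Schur product *)

(** Only the quadratic form is constrained; symmetry of [K] is a separate hypothesis of the lemmas
    that use it. *)
Definition psd (R : realType) (T : finType) (K : T -> T -> R) : Prop :=
  forall c : T -> R, 0 <= \sum_p \sum_q c p * c q * K p q.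

Lemma eq_psd (R : realType) (T : finType) (K L : T -> T -> R) :
  (forall p q, K p q = L p q) -> psd K -> psd L.
Proof.
move=> KL K0 c; rewrite (_ : \sum_p _ = \sum_p \sum_q c p * c q * K p q) //.
by apply: eq_bigr => p _; apply: eq_bigr => q _; rewrite KL.
Qed.

Lemma psd_scale (R : realType) (T : finType) (f : T -> R) (K : T -> T -> R) :
  psd K -> psd (fun p q => f p * f q * K p q).
Proof.
move=> K0 c; have := K0 (fun p => c p * f p).
rewrite (_ : \sum_p _ = \sum_p \sum_q c p * c q * (f p * f q * K p q)) //.
by apply: eq_bigr => p _; apply: eq_bigr => q _; ring.
Qed.

Lemma psd_const (R : realType) (T : finType) (k : R) :
  0 <= k -> psd (fun _ _ : T => k).
Proof.
move=> k0 c; rewrite (_ : \sum_p _ = (\sum_p c p) ^+ 2 * k).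
  by rewrite mulr_ge0 // sqr_ge0.
rewrite expr2 big_distrlr /= mulr_suml.
by apply: eq_bigr => p _; rewrite mulr_suml.
Qed.

(** Expansion of the form along the line [c + x e_r]. Later [x] is chosen either to minimise the
    form or to make the coefficients sum to zero. *)
Lemma quad_sum_shift (R : realType) (T : finType) (K : T -> T -> R) :
  (forall p q, K p q = K q p) -> forall (c : T -> R) r x,
  \sum_p \sum_q (c p + x * (p == r)%:R) * (c q + x * (q == r)%:R) * K p q =
  \sum_p \sum_q c p * c q * K p q + 2 * x * (\sum_q c q * K r q)
  + x ^+ 2 * K r r.
Proof.
move=> Ksym c r x.
have sumr (f : T -> R) : \sum_q (q == r)%:R * f q = f r.
  rewrite (bigD1 r) //= eqxx mul1r big1 ?addr0 // => q /negbTE ->.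
  by rewrite mul0r.
have inner p : \sum_q (c p + x * (p == r)%:R) * (c q + x * (q == r)%:R) * K p q
   = \sum_q c p * c q * K p q + x * (c p * K r p)
     + (p == r)%:R * (x * (\sum_q c q * K p q) + x ^+ 2 * K p r).
  transitivity ((c p + x * (p == r)%:R) *
      (\sum_q c q * K p q + x * \sum_q (q == r)%:R * K p q)).
    rewrite mulr_sumr -big_split mulr_sumr /=.
    by apply: eq_bigr => q _; ring.
  rewrite sumr (_ : \sum_q c p * c q * K p q = c p * \sum_q c q * K p q).
    by rewrite (Ksym r p); ring.
  by rewrite mulr_sumr; apply: eq_bigr => q _; ring.
under eq_bigr do rewrite inner.
rewrite 2!big_split /= sumr -mulr_sumr.
by set S := \sum_p \sum_q _; set L := \sum_q c q * K r q; ring.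
Qed.

Lemma psd_shift (R : realType) (T : finType) (K : T -> T -> R) :
  (forall p q, K p q = K q p) -> psd K -> forall c r x,
  0 <= (\sum_p \sum_q c p * c q * K p q) + 2 * x * (\sum_q c q * K r q)
       + x ^+ 2 * K r r.
Proof. by move=> Ksym K0 c r x; rewrite -quad_sum_shift. Qed.

Lemma psd_diag (R : realType) (T : finType) (K : T -> T -> R) r :
  (forall p q, K p q = K q p) -> psd K -> 0 <= K r r.
Proof.
move=> Ksym K0; have := psd_shift Ksym K0 (fun=> 0) r 1.
rewrite big1; last by move=> p _; rewrite big1 // => q _; rewrite !mul0r.
by rewrite big1 => [|q _]; [lra|rewrite mul0r].
Qed.

Lemma psd_row_eq0 (R : realType) (T : finType) (K : T -> T -> R) r q :
  (forall p q, K p q = K q p) -> psd K -> K r r = 0 -> K r q = 0.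
Proof.
move=> Ksym K0 Kr0.
have sumd (f : T -> R) : \sum_p (p == q)%:R * f p = f q.
  rewrite (bigD1 q) //= eqxx mul1r big1 ?addr0 // => p /negbTE ->.
  by rewrite mul0r.
apply/eqP; apply: contraT => nz.
(* With [K r r = 0] the form is affine in [x]; this [x] would give it the value -1. *)
have := psd_shift Ksym K0 (fun p => (p == q)%:R) r (- (K q q + 1) / (2 * K r q)).
rewrite sumd Kr0 (_ : \sum_p _ = K q q).
  rewrite (_ : 2 * _ * K r q = - (K q q + 1)); first by lra.
  by field.
rewrite -[RHS](sumd (fun p => K p q)); apply: eq_bigr => p _.
under eq_bigr do rewrite -mulrA.
by rewrite -mulr_sumr sumd.
Qed.

(* Schur complements clear the rows of [K] one after the other. *)
Lemma psd_gram_on (R : realType) (T : finType) (s : seq T) (K : T -> T -> R) :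
  (forall p q, K p q = K q p) -> psd K ->
  (forall p q, p \notin s -> K p q = 0) ->
  exists vs : seq (T -> R), forall p q, K p q = \sum_(v <- vs) v p * v q.
Proof.
elim: s K => [|r s IH] K Ksym K0 Ks.
  by exists [::] => p q; rewrite big_nil Ks.
have [Kr0|Krn] := eqVneq (K r r) 0.
  apply: IH => // p q ps; have [->|pr] := eqVneq p r.
    exact: psd_row_eq0.
  by apply: Ks; rewrite in_cons negb_or pr.
have Krp : 0 < K r r by rewrite lt_neqAle eq_sym Krn psd_diag.
have [||p q ps|vs Kvs] := IH (fun p q => K p q - K r p * K r q / K r r).
- by move=> p q; rewrite Ksym [K r p * _]mulrC.
(* This [x] minimises the form over the weight at [r]; the minimum is the form of the Schur
   complement. *)
- move=> c; have := psd_shift Ksym K0 c r (- (\sum_q c q * K r q) / K r r).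
  set L := \sum_q c q * K r q => H.
  rewrite (_ : \sum_p _ = \sum_p \sum_q c p * c q * K p q - L * L / K r r).
    apply: le_trans H _; rewrite le_eqVlt; apply/orP; left; apply/eqP.
    by field.
  rewrite /L big_distrlr /= mulr_suml -sumrB.
  apply: eq_bigr => p _; rewrite mulr_suml -sumrB.
  by apply: eq_bigr => q _; ring.
- have [->|pr] := eqVneq p r; first by field.
  by rewrite (Ksym r p) !(Ks p) ?in_cons ?negb_or ?pr // !mul0r subr0.
(* The rank-one part that was subtracted comes from row [r] divided by the square root of its
   pivot. *)
exists ((fun p => K r p / Num.sqrt (K r r)) :: vs) => p q.
rewrite big_cons -Kvs -{3}(sqr_sqrtr (ltW Krp)).
have : Num.sqrt (K r r) != 0 by rewrite gt_eqF // sqrtr_gt0.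
by move=> ?; field.
Qed.

Lemma psd_gram (R : realType) (T : finType) (K : T -> T -> R) :
  (forall p q, K p q = K q p) -> psd K ->
  exists vs : seq (T -> R), forall p q, K p q = \sum_(v <- vs) v p * v q.
Proof.
by move=> Ksym K0; apply: (@psd_gram_on _ _ (enum T)) => // p q; rewrite mem_enum.
Qed.

(** Schur product theorem: [K] is a sum of rank-one kernels, and multiplying [L] by a rank-one
    kernel is a rescaling. *)
Lemma psd_mul (R : realType) (T : finType) (K L : T -> T -> R) :
  (forall p q, K p q = K q p) -> psd K -> psd L ->
  psd (fun p q => K p q * L p q).
Proof.
move=> Ksym K0 L0; have [vs Kvs] := psd_gram Ksym K0.
apply: (@eq_psd _ _ (fun p q => \sum_(v <- vs) v p * v q * L p q)).
  by move=> p q; rewrite Kvs mulr_suml.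
move=> c; rewrite (_ : \sum_p _ =
    \sum_(v <- vs) \sum_p \sum_q c p * c q * (v p * v q * L p q)).
  by apply: sumr_ge0 => v _; apply: psd_scale.
rewrite [RHS]exchange_big; apply: eq_bigr => p _ /=.
rewrite [RHS]exchange_big; apply: eq_bigr => q _ /=.
by rewrite mulr_sumr.
Qed.

(** * Integrals of kernels and the one-dimensional Gaussian integral *)

Lemma psd_Rintegral d (X : measurableType d) (R : realType) (T : finType)
    (mu : {measure set X -> \bar R}) (D : set X) (K : X -> T -> T -> R) :
  measurable D ->
  (forall p q, mu.-integrable D (EFin \o (fun s => K s p q))) ->
  (forall s, D s -> psd (K s)) ->
  psd (fun p q => \int[mu]_(s in D) K s p q).
Proof.
move=> mD Kint K0 c.
have intc p q : mu.-integrable D (EFin \o (fun s => c p * c q * K s p q)).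
  by apply: eq_integrable (integrableZl mD (c p * c q) (Kint p q)).
have ints p :
    mu.-integrable D (EFin \o (fun s => \sum_q c p * c q * K s p q)).
  pose h q := EFin \o (fun s => c p * c q * K s p q).
  apply: eq_integrable (integrable_sum mD (index_enum T) (h := h) _) => [//|s _|q _].
    by rewrite /h /= sumEFin.
  exact: intc.
have Rsum (g : T -> X -> R) : (forall q, mu.-integrable D (EFin \o g q)) ->
    \int[mu]_(s in D) (\sum_q g q s) = \sum_q \int[mu]_(s in D) g q s.
  move=> gint; rewrite /Rintegral.
  under eq_integral do rewrite -sumEFin.
  rewrite integral_sum // -sum_fine // => q _.
  exact: integrable_fin_num mD _ (gint q).
rewrite (_ : \sum_p _ =
    \int[mu]_(s in D) (\sum_p \sum_q c p * c q * K s p q)).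
  by apply: Rintegral_ge0 => s Ds; exact: K0.
rewrite Rsum //; apply: eq_bigr => p _.
rewrite Rsum //; apply: eq_bigr => q _.
by rewrite RintegralZl.
Qed.

(** Completing the square gives a multiple of the normal density with mean [b / (2 * a)] and
    variance [1 / (2 * a)], whose integral is 1. *)
Lemma integrable_gauss (R : realType) (a b : R) : 0 < a ->
  (@lebesgue_measure R).-integrable setT
    (EFin \o (fun s => expR (- (a * s ^+ 2) + b * s))) /\
  \int[@lebesgue_measure R]_s expR (- (a * s ^+ 2) + b * s) =
    Num.sqrt pi * ((Num.sqrt a)^-1 * expR (b ^+ 2 / a / 4)).
Proof.
move=> a0; pose sg := (Num.sqrt (2 * a))^-1; pose mn := b / (2 * a).
have a2 : 0 < 2 * a by rewrite mulr_gt0.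
have sg0 : sg != 0 by rewrite invr_eq0 gt_eqF // sqrtr_gt0.
have sgE : sg ^+ 2 = (2 * a)^-1 by rewrite exprVn sqr_sqrtr // ltW.
pose k := Num.sqrt pi * ((Num.sqrt a)^-1 * expR (b ^+ 2 / a / 4)).
have an0 : a != 0 by rewrite gt_eqF.
have E s : expR (- (a * s ^+ 2) + b * s) = k * normal_pdf mn sg s.
  rewrite normal_pdfE // /normal_peak /normal_fun sgE /k.
  rewrite (_ : (2 * a)^-1 * pi *+ 2 = pi / a); last by field.
  rewrite sqrtrM ?pi_ge0 // sqrtrV ?ltW // invfM invrK.
  have pn : Num.sqrt (pi : R) != 0 by rewrite gt_eqF // sqrtr_gt0 pi_gt0.
  have sn : Num.sqrt a != 0 by rewrite gt_eqF // sqrtr_gt0.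
  rewrite (_ : - _ + _ = b ^+ 2 / a / 4 + - (s - mn) ^+ 2 / ((2 * a)^-1 *+ 2)).
    by rewrite expRD; field; rewrite pn sn.
  by rewrite /mn; field.
have I := integrable_normal_pdf mn sg.
rewrite (funext E : (fun s => expR (- (a * s ^+ 2) + b * s)) = _).
split.
  by apply: eq_integrable (integrableZl measurableT k I).
by rewrite RintegralZl // /Rintegral integral_normal_pdf /= mulr1.
Qed.

(** * Symmetric positive definite matrices and Schur complements *)

Lemma sym_posdef_tr (R : realType) d (S : 'M[R]_d) : sym_posdef_mx S -> S^T = S.
Proof.
by case=> + _; rewrite is_hermitianmxE expr0 scale1r map_mx_id // => /eqP <-.
Qed.

Lemma sym_posdefP (R : realType) d (S : 'M[R]_d) : S^T = S ->
  (forall v : 'cV[R]_d, v != 0 -> 0 < (v^T *m S *m v) 0 0) -> sym_posdef_mx S.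
Proof.
move=> St S0; split=> //.
by rewrite is_hermitianmxE expr0 scale1r map_mx_id // St.
Qed.

Lemma sym_posdef_unitmx (R : realType) d (S : 'M[R]_d) :
  sym_posdef_mx S -> S \in unitmx.
Proof.
case=> _ S0; rewrite unitmxE unitfE; apply/det0P => -[v v0 vS].
have := S0 v^T; rewrite trmx_eq0 => /(_ v0).
by rewrite trmxK vS mul0mx mxE ltxx.
Qed.

Lemma sym_posdefD (R : realType) d (S1 S2 : 'M[R]_d) :
  sym_posdef_mx S1 -> sym_posdef_mx S2 -> sym_posdef_mx (S1 + S2).
Proof.
move=> P1 P2; apply: sym_posdefP => [|v v0].
  by rewrite linearD /= !sym_posdef_tr.
by rewrite mulmxDr mulmxDl mxE addr_gt0 ?P1.2 ?P2.2.
Qed.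

Lemma sym_posdefZ (R : realType) d (k : R) (S : 'M[R]_d) :
  0 < k -> sym_posdef_mx S -> sym_posdef_mx (k *: S).
Proof.
move=> k0 P; apply: sym_posdefP => [|v v0].
  by rewrite linearZ /= sym_posdef_tr.
by rewrite -scalemxAr -scalemxAl mxE mulr_gt0 ?P.2.
Qed.

Lemma sym_posdefV (R : realType) d (S : 'M[R]_d) :
  sym_posdef_mx S -> sym_posdef_mx (invmx S).
Proof.
move=> P; have U := sym_posdef_unitmx P.
have Vt : (invmx S)^T = invmx S by rewrite trmx_inv sym_posdef_tr.
apply: sym_posdefP => // v v0.
have := P.2 (invmx S *m v); rewrite trmx_mul Vt -!mulmxA.
rewrite (mulmxA S) mulmxV // mul1mx mulmxA; apply.
apply: contraNneq v0 => /(congr1 (mulmx S)).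
by rewrite mulmxA mulmxV // mul1mx mulmx0 => ->.
Qed.

(** Block elimination of the first coordinate: it reduces the determinant and the quadratic form of
    the inverse to dimension [d], for inductions on the dimension. *)
Lemma schur_complement (R : realType) d (S : 'M[R]_(1 + d)) :
  sym_posdef_mx S ->
  let D := drsubmx S in let r := dlsubmx S in
  let s := (ulsubmx S - r^T *m invmx D *m r) 0 0 in
  [/\ sym_posdef_mx D, 0 < s, \det S = s * \det D &
   forall b : 'cV[R]_(1 + d),
     (b^T *m invmx S *m b) 0 0 =
     ((dsubmx b)^T *m invmx D *m dsubmx b) 0 0
     + (b 0 0 - (r^T *m invmx D *m dsubmx b) 0 0) ^+ 2 / s].
Proof.
move=> P D r s; have St := sym_posdef_tr P.
have [_ rt _ Dt] : [/\ (ulsubmx S)^T = ulsubmx S, r^T = ursubmx S,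
    (ursubmx S)^T = r & D^T = D].
  apply: eq_block_mx; rewrite -[RHS]/(block_mx _ _ _ _) submxK.
  by rewrite -tr_block_mx submxK.
have SE : S = block_mx (ulsubmx S) r^T r D by rewrite rt submxK.
have PD : sym_posdef_mx D.
  apply: sym_posdefP => // v v0; have := P.2 (col_mx 0 v).
  rewrite SE tr_col_mx mul_row_block mul_row_col !trmx0 !mul0mx !mulmx0 !add0r.
  apply; apply: contraNneq v0 => /(congr1 dsubmx).
  by rewrite col_mxKd linear0 => ->.
have DU := sym_posdef_unitmx PD.
have sE : ulsubmx S - r^T *m invmx D *m r = s%:M by rewrite [LHS]mx11_scalar.
have s0 : 0 < s.
  (* On this vector the lower block of the product with [S] vanishes, and the form takes the value
     [s]. *)
  have := P.2 (col_mx 1%:M (- (invmx D *m r))).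
  rewrite -mulmxA SE mul_block_col !mulmxN !mulmx1 !mulmxA mulmxV // mul1mx.
  rewrite subrr sE tr_col_mx mul_row_col mulmx0 addr0 trmx1 mul1mx mxE eqxx.
  apply; apply/eqP => /(congr1 usubmx); rewrite col_mxKu linear0.
  by move/matrixP/(_ 0 0); rewrite !mxE eqxx => /eqP; rewrite oner_eq0.
split=> //.
  (* A column operation of determinant 1 clears the lower left block. *)
  have : \det (S *m block_mx 1%:M 0 (- (invmx D *m r)) 1%:M) = s * \det D.
    rewrite SE mulmx_block !mulmxN !mulmx1 !mulmx0 !mulmxA mulmxV // mul1mx.
    by rewrite subrr !add0r sE det_ublock det_scalar1.
  by rewrite det_mulmx det_lblock !det1 !mulr1.
move=> b; set b' := dsubmx b.
(* Back substitution in [S x = b]: [e] is the first coordinate of the solution, and [x] below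
   completes it. *)
pose z := (r^T *m invmx D *m b') 0 0; pose e := (b 0 0 - z) / s.
have bE : b = col_mx (b 0 0)%:M b'.
  rewrite -{1}[b]vsubmxK; congr col_mx.
  by rewrite [LHS]mx11_scalar mxE; congr (b _ _)%:M; apply: val_inj.
have zE : r^T *m invmx D *m b' = z%:M by rewrite [LHS]mx11_scalar.
have se : s * e = b 0 0 - z by rewrite /e mulrC divfK // gt_eqF.
pose x := col_mx e%:M (invmx D *m (b' - e *: r)).
have Sx : S *m x = b.
  rewrite [RHS]bE {1}SE mul_block_col; congr col_mx.
    rewrite mulmxA mulmxBr zE -scalemxAr.
    rewrite (_ : ulsubmx S = s%:M + r^T *m invmx D *m r); last by rewrite -sE subrK.
    rewrite mul_mx_scalar scalerDr scale_scalar_mx mulrC se.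
    by rewrite addrACA subrr addr0 -raddfD /= subrK.
  by rewrite mulmxA mulmxV // mul1mx mul_mx_scalar addrC subrK.
have Ve : invmx S *m b = x by rewrite -Sx mulKmx ?sym_posdef_unitmx.
rewrite -mulmxA Ve {1}bE tr_col_mx mul_row_col !mulmxBr -!scalemxAr.
have -> : b'^T *m (invmx D *m r) = z%:M.
  by rewrite -[RHS]tr_scalar_mx -zE !trmx_mul trmxK trmx_inv Dt mulmxA.
rewrite -/z tr_scalar_mx -scalar_mxM mulmxA.
move: (b'^T *m invmx D *m b') => Q; rewrite !mxE eqxx !mulr1n.
have -> : b 0 0 = s * e + z by rewrite se subrK.
have sn : s != 0 by rewrite gt_eqF.
by field.
Qed.

(** The determinant is the product of the successive positive Schur complements. *)
Lemma sym_posdef_det_gt0 (R : realType) d (S : 'M[R]_d) :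
  sym_posdef_mx S -> 0 < \det S.
Proof.
elim: d S => [|d IH] S P; first by rewrite det_mx00.
have [PD s0 -> _] := schur_complement (d := d) P.
by rewrite mulr_gt0 // IH.
Qed.

(** * Inner products of Gaussians and the spatial factor *)

Lemma quad_formDZ (R : realType) d (V : 'M[R]_d) (u v : 'cV[R]_d) k :
  V^T = V ->
  ((u + k *: v)^T *m V *m (u + k *: v)) 0 0 =
  (u^T *m V *m u) 0 0 + 2 * k * (v^T *m V *m u) 0 0
  + k ^+ 2 * (v^T *m V *m v) 0 0.
Proof.
move=> Vt; have C : (u^T *m V *m v) 0 0 = (v^T *m V *m u) 0 0.
  by rewrite -[u^T *m V *m v]trmxK mxE !trmx_mul trmxK Vt mulmxA.
have -> : (u + k *: v)^T = u^T + k *: v^T by rewrite linearD linearZ.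
rewrite !mulmxDl !mulmxDr -!scalemxAl -!scalemxAr.
move: (u^T *m V *m u) (u^T *m V *m v) (v^T *m V *m u) (v^T *m V *m v) C.
by move=> a b c e C; rewrite !mxE C; ring.
Qed.

Lemma quad_formZ (R : realType) d (V : 'M[R]_d) (v : 'cV[R]_d) k :
  ((k *: v)^T *m V *m (k *: v)) 0 0 = k ^+ 2 * (v^T *m V *m v) 0 0.
Proof.
have -> : (k *: v)^T = k *: v^T by rewrite linearZ.
by rewrite -!scalemxAl -scalemxAr scalerA -expr2 mxE.
Qed.

(* Up to the factor [sqrt pi ^+ d] this is the L^2 inner product of the functions
   [z |-> expR (- z^T A z + b^T z)]; integrating one coordinate at a time keeps
   all integrals one-dimensional. *)
Lemma psd_gauss (R : realType) d (T : finType) (A : T -> 'M[R]_d)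
    (b : T -> 'cV[R]_d) :
  (forall p, sym_posdef_mx (A p)) ->
  psd (fun p q => (Num.sqrt (\det (A p + A q)))^-1 *
    expR (((b p + b q)^T *m invmx (A p + A q) *m (b p + b q)) 0 0 / 4)).
Proof.
elim: d A b => [|d IH] A b P.
  apply: (@eq_psd _ _ (fun _ _ => 1)); last exact: psd_const.
  by move=> p q; rewrite det_mx00 sqrtr1 invr1 mul1r thinmx0 mul0mx mxE mul0r expR0.
pose D p := drsubmx (A p : 'M[R]_(1 + d)).
pose r p := dlsubmx (A p : 'M[R]_(1 + d)).
pose al p := (ulsubmx (A p : 'M[R]_(1 + d))) 0 0.
pose b' p := dsubmx (b p : 'cV[R]_(1 + d)).
(* With the first coordinate of [z] fixed to [s], the exponent splits into the scalar part [g] and a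
   Gaussian exponent in the remaining coordinates, whose linear term is [b' - 2 s r]. So [K s] is a
   rescaled instance of the induction hypothesis. *)
pose g s p := expR (- (al p * s ^+ 2) + b p 0 0 * s).
pose K s p q := g s p * g s q * ((Num.sqrt (\det (D p + D q)))^-1 *
  expR ((((b' p + (- (2 * s)) *: r p) + (b' q + (- (2 * s)) *: r q))^T
        *m invmx (D p + D q) *m
        ((b' p + (- (2 * s)) *: r p) + (b' q + (- (2 * s)) *: r q))) 0 0 / 4)).
have PD p : sym_posdef_mx (D p) by have [] := schur_complement (d := d) (P p).
have K0 s : psd (K s) by apply/psd_scale/IH.
pose k p q := (Num.sqrt (\det (D p + D q)))^-1 *
  expR (((b' p + b' q)^T *m invmx (D p + D q) *m (b' p + b' q)) 0 0 / 4).
pose z p q := ((r p + r q)^T *m invmx (D p + D q) *m (b' p + b' q)) 0 0.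
pose sg p q := al p + al q -
  ((r p + r q)^T *m invmx (D p + D q) *m (r p + r q)) 0 0.
pose e p q := b p 0 0 + b q 0 0 - z p q.
(* As a function of [s] this is again a Gaussian; its quadratic coefficient [sg] is the Schur
   complement of [A p + A q]. *)
have KE p q s : K s p q = k p q * expR (- (sg p q * s ^+ 2) + e p q * s).
  rewrite /K /k addrACA -scalerDr quad_formDZ; last first.
    by rewrite trmx_inv sym_posdef_tr //; exact: sym_posdefD.
  rewrite [LHS]mulrCA -[RHS]mulrA; congr (_ * _); rewrite /g -!expRD; congr expR.
  by rewrite /sg /e /z; field.
have [sg0 detE quadE] : [/\ forall p q, 0 < sg p q,
    forall p q, \det (A p + A q) = sg p q * \det (D p + D q) &
    forall p q, ((b p + b q)^T *m invmx (A p + A q) *m (b p + b q)) 0 0 =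
     ((b' p + b' q)^T *m invmx (D p + D q) *m (b' p + b' q)) 0 0 +
     e p q ^+ 2 / sg p q].
  have Hs p q : (ulsubmx (A p + A q : 'M[R]_(1 + d)) -
     (r p + r q)^T *m invmx (D p + D q) *m (r p + r q)) 0 0 = sg p q.
    by rewrite /sg /al !mxE.
  have DD p q : drsubmx (A p + A q : 'M[R]_(1 + d)) = D p + D q.
    by apply/matrixP => i j; rewrite !mxE.
  have rD p q : dlsubmx (A p + A q : 'M[R]_(1 + d)) = r p + r q.
    by apply/matrixP => i j; rewrite !mxE.
  have bD p q : dsubmx (b p + b q : 'cV[R]_(1 + d)) = b' p + b' q.
    by apply/matrixP => i j; rewrite !mxE.
  split=> p q; have [_ + + +] := schur_complement (d := d) (sym_posdefD (P p) (P q));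
    rewrite DD rD Hs // => _ _ ->.
  by rewrite bD [(b p + b q) 0 0]mxE.
(* Integrating out [s] produces one factor [sqrt pi], which the constant in front cancels. *)
apply: (@eq_psd _ _ (fun p q => (Num.sqrt pi)^-1 *
   \int[@lebesgue_measure R]_s K s p q)).
  move=> p q; have [I J] := integrable_gauss (e p q) (sg0 p q).
  rewrite (funext (KE p q)) RintegralZl // J detE quadE [(_ + _) / 4]mulrDl expRD /k.
  rewrite sqrtrM ?(ltW (sg0 p q)) // invfM.
  rewrite mulrCA mulKf; first by ring.
  by rewrite gt_eqF // sqrtr_gt0 pi_gt0.
apply: psd_mul => //; first by apply: psd_const; rewrite invr_ge0 sqrtr_ge0.
apply: psd_Rintegral => // p q; have [I _] := integrable_gauss (e p q) (sg0 p q).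
rewrite (funext (KE p q)).
by apply: eq_integrable (integrableZl measurableT (k p q) I).
Qed.

(** Parallel sum identity: the minimum over [w] of [(u-w)^T P (u-w) + (v-w)^T Q (v-w)] is the form
    of the inverse of [P^-1 + Q^-1 = (A + B) / 2] at [u - v]. *)
Lemma quad_form_parallel (R : realType) d (A B : 'M[R]_d) (u v : 'cV[R]_d) :
  sym_posdef_mx A -> sym_posdef_mx B ->
  let P := 2 *: invmx A in let Q := 2 *: invmx B in
  ((P *m u + Q *m v)^T *m invmx (P + Q) *m (P *m u + Q *m v)) 0 0 =
  (u^T *m P *m u) 0 0 + (v^T *m Q *m v) 0 0
  - ((u - v)^T *m invmx (2^-1 *: (A + B)) *m (u - v)) 0 0.
Proof.
move=> PA PB P Q; have two0 : (2 : R) != 0 by rewrite pnatr_eq0.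
have UA := sym_posdef_unitmx PA; have UB := sym_posdef_unitmx PB.
have PP : sym_posdef_mx P by apply/sym_posdefZ/sym_posdefV.
have PQ : sym_posdef_mx Q by apply/sym_posdefZ/sym_posdefV.
have UM : 2^-1 *: (A + B) \in unitmx.
  by apply/sym_posdef_unitmx/sym_posdefZ/sym_posdefD; rewrite ?invr_gt0.
have UPQ := sym_posdef_unitmx (sym_posdefD PP PQ).
set h := u - v; set S := invmx (2^-1 *: (A + B)).
(* The minimiser [(P + Q)^-1 (P u + Q v)], written as [u - P^-1 S h]. *)
pose w := u - 2^-1 *: (A *m (S *m h)).
have Pw : P *m w = P *m u - S *m h.
  rewrite mulmxBr /P -!scalemxAl -scalemxAr scalerA divff // scale1r.
  by rewrite mulKmx.
have Qw : Q *m w = Q *m v + S *m h.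
  have MS : A *m (S *m h) + B *m (S *m h) = 2 *: h.
    by rewrite -mulmxDl -[A + B](scalerKV two0) -scalemxAl mulKVmx.
  rewrite /w; have -> : A *m (S *m h) = 2 *: h - B *m (S *m h).
    by rewrite -MS addrK.
  rewrite scalerBr scalerA mulVf // scale1r opprB addrC.
  rewrite -addrA [- _ + _]addrC /h subKr mulmxDr [RHS]addrC; congr (_ + _).
  by rewrite /Q -scalemxAl -scalemxAr scalerA divff // scale1r mulKmx.
have wE : invmx (P + Q) *m (P *m u + Q *m v) = w.
  have -> : P *m u + Q *m v = (P + Q) *m w.
    by rewrite mulmxDl Pw Qw addrACA [- _ + _]addrC subrr addr0.
  by rewrite mulKmx.
have -> : (P *m u + Q *m v)^T = u^T *m P + v^T *m Q.
  by rewrite linearD /= !trmx_mul (sym_posdef_tr PP) (sym_posdef_tr PQ).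
rewrite -mulmxA wE mulmxDl -!mulmxA Pw Qw mulmxBr mulmxDr.
have -> : h^T = u^T - v^T by rewrite /h linearB.
rewrite mulmxBl.
move: (u^T *m (P *m u)) (u^T *m (S *m h)) (v^T *m (Q *m v)) (v^T *m (S *m h)).
by move=> a b c e; rewrite !mxE; ring.
Qed.

(** Up to a constant, this is the inner product of the L^2-normalised Gaussians
    [expR (- (z - u)^T P (z - u))] with [P = 2 A^-1]. *)
Lemma psd_spatial (R : realType) d (T : finType) (A : T -> 'M[R]_d)
    (u : T -> 'cV[R]_d) :
  (forall p, sym_posdef_mx (A p)) ->
  psd (fun p q => \det (A p) `^ (1 / 4) * \det (A q) `^ (1 / 4)
    / \det (2^-1 *: (A p + A q)) `^ (1 / 2)
    * expR (- ((u p - u q)^T *m invmx (2^-1 *: (A p + A q)) *m (u p - u q)) 0 0)).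
Proof.
move=> PA; pose P p := 2 *: invmx (A p).
have PP p : sym_posdef_mx (P p) by apply/sym_posdefZ/sym_posdefV.
have detA p := sym_posdef_det_gt0 (PA p).
pose x p := \det (A p) `^ (1 / 4).
have x0 p : 0 < x p by rewrite powR_gt0.
have xE p : \det (A p) = x p ^+ 4.
  by rewrite -powR_mulrn ?ltW // -powRrM mul1r mulVf ?powRr1 ?ltW ?pnatr_eq0.
(* The exponential completes the square around [u p]; [x p] is the L^2 norm of the Gaussian up to a
   constant. *)
pose f p := (x p)^-1 * expR (- ((u p)^T *m P p *m u p) 0 0).
have PM p q : sym_posdef_mx (2^-1 *: (A p + A q)).
  by apply/sym_posdefZ/sym_posdefD; rewrite ?invr_gt0.
have detM p q := sym_posdef_det_gt0 (PM p q).
(* From the factorisation [A^-1 + B^-1 = A^-1 (A + B) B^-1]. *)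
have detP p q : Num.sqrt (\det (P p + P q)) =
    2 ^+ d * Num.sqrt (\det (2^-1 *: (A p + A q))) / (x p ^+ 2 * x q ^+ 2).
  have -> : P p + P q = 4 *: (invmx (A p) *m (2^-1 *: (A p + A q)) *m invmx (A q)).
    rewrite -scalemxAr -scalemxAl mulmxDr mulVmx ?sym_posdef_unitmx //.
    rewrite mulmxDl mul1mx mulmxK ?sym_posdef_unitmx // scalerA /P -scalerDr addrC.
    by congr (_ *: _); field.
  rewrite detZ !det_mulmx !det_inv !xE.
  have -> : 4 ^+ d * ((x p ^+ 4)^-1 * \det (2^-1 *: (A p + A q)) * (x q ^+ 4)^-1) =
     (2 ^+ d / (x p ^+ 2 * x q ^+ 2)) ^+ 2 * \det (2^-1 *: (A p + A q)).
    have -> : (4 : R) = 2 ^+ 2 by ring.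
    by rewrite -exprM mulnC exprM; field; rewrite !gt_eqF.
  rewrite sqrtrM ?sqr_ge0 // sqrtr_sqr ger0_norm; first by ring.
  by rewrite divr_ge0 ?mulr_ge0 ?exprn_ge0 // ltW.
have quarter (a : R) : 2 ^+ 2 * a / 4 = a by field.
have K0 := psd_gauss (fun p => 2 *: (P p *m u p)) PP.
(* The constant [2 ^+ d] cancels the one in [detP]. *)
apply: eq_psd (psd_mul _ (@psd_const R T (2 ^+ d) _) (psd_scale f K0)) => //.
- move=> p q /=; rewrite detP (div1r 2) powR12_sqrt ?ltW //.
  rewrite -/(x p) -/(x q) -scalerDr.
  rewrite quad_formZ quarter.
  rewrite quad_form_parallel // /f -addrA !expRD.
  have := sqrtr_gt0 (\det (2^-1 *: (A p + A q))); rewrite detM.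
  move: (Num.sqrt _) => y y0.
  rewrite !expRN.
  by field; rewrite ?gt_eqF ?expR_gt0 ?exprn_gt0.
Qed.

(** * Exponentials of kernels and Schoenberg's theorem *)

(** The integral of [expR (- s^2 / 2 + (v p + v q) s)] over [s] is proportional to
    [expR ((v p + v q)^2 / 2)], which is the kernel up to rescaling; for each [s] the integrand has
    rank one. *)
Lemma psd_expR_mul (R : realType) (T : finType) (v : T -> R) :
  psd (fun p q => expR (v p * v q)).
Proof.
pose K s p q := expR (- (s ^+ 2 / 4) + v p * s) * expR (- (s ^+ 2 / 4) + v q * s) * 1.
have h0 : 0 < (2^-1 : R) by rewrite invr_gt0.
have KE p q s : K s p q = expR (- (2^-1 * s ^+ 2) + (v p + v q) * s).
  by rewrite /K mulr1 -expRD; congr expR; field.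
have K0 s : psd (K s) by apply/psd_scale/psd_const.
have I0 : psd (fun p q => \int[@lebesgue_measure R]_s K s p q).
  apply: psd_Rintegral => // p q; rewrite (funext (KE p q)).
  by have [] := integrable_gauss (v p + v q) h0.
pose k : R := (Num.sqrt pi)^-1 * Num.sqrt 2^-1.
apply: eq_psd (psd_mul _ (@psd_const R T k _)
  (psd_scale (fun p => expR (- (v p ^+ 2 / 2))) I0)) => //; last first.
  by rewrite mulr_ge0 ?invr_ge0 ?sqrtr_ge0.
move=> p q; rewrite (funext (KE p q)).
have [_ ->] := integrable_gauss (v p + v q) h0.
rewrite (_ : v p * v q = - (v p ^+ 2 / 2) + (- (v q ^+ 2 / 2)
  + (v p + v q) ^+ 2 / 2^-1 / 4)); last by field.
rewrite !expRD /k; field.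
by rewrite !gt_eqF ?sqrtr_gt0 ?pi_gt0.
Qed.

(** A Gram decomposition turns the exponential into a finite Schur product of kernels
    [expR (v p * v q)]. *)
Lemma psd_expR (R : realType) (T : finType) (K : T -> T -> R) :
  (forall p q, K p q = K q p) -> psd K -> psd (fun p q => expR (K p q)).
Proof.
move=> Ksym K0; have [vs Kvs] := psd_gram Ksym K0.
apply: (@eq_psd _ _ (fun p q => expR (\sum_(v <- vs) v p * v q))).
  by move=> p q; rewrite Kvs.
elim: vs {Kvs} => [|v vs IH].
  by apply: eq_psd (@psd_const R T 1 ler01) => p q; rewrite big_nil expR0.
apply: eq_psd (psd_mul _ (psd_expR_mul v) IH) => p q.
  by rewrite big_cons expRD.
by rewrite mulrC.
Qed.

Lemma schoenberg (R : realType) (T : finType) (g : T -> T -> R) (t : R) :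
  (forall p q, g p q = g q p) ->
  (forall c : T -> R, \sum_p c p = 0 -> \sum_p \sum_q c p * c q * g p q <= 0) ->
  0 <= t -> psd (fun p q => expR (- (t * g p q))).
Proof.
(* An empty index type offers no base point [r], but its sums are empty. *)
move=> gsym gneg t0; case: (pickP (@predT T)) => [r _|T0]; last first.
  by move=> c; rewrite big_pred0.
pose phi p q := t * (g r p + g r q - g p q - g r r).
have phi0 : psd phi.
  (* The weight [x] added at [r] makes the coefficients sum to zero. The form of [g] at the shifted
     coefficients, times [- t], is the form of [phi] at [c]. *)
  move=> c; pose x := - \sum_p c p; pose L := \sum_q c q * g r q.
  pose F := \sum_p \sum_q c p * c q * g p q.
  have := gneg (fun p => c p + x * (p == r)%:R).
  rewrite quad_sum_shift // -/L -/F.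
  have -> : \sum_p (c p + x * (p == r)%:R) = 0.
    rewrite big_split /= -mulr_sumr (_ : \sum_p (p == r)%:R = 1).
      by rewrite mulr1 subrr.
    by rewrite (bigD1 r) //= eqxx big1 ?addr0 // => p /negbTE ->.
  move=> /(_ erefl) H.
  have cL : (\sum_p c p) * L = \sum_p \sum_q c p * c q * g r q.
    rewrite big_distrlr /=; apply: eq_bigr => p _; apply: eq_bigr => q _; ring.
  have Lc : L * (\sum_p c p) = \sum_p \sum_q c p * c q * g r p.
    rewrite big_distrlr /=; apply: eq_bigr => p _; apply: eq_bigr => q _; ring.
  have cc : (\sum_p c p) * (\sum_p c p) * g r r = \sum_p \sum_q c p * c q * g r r.
    rewrite big_distrlr /= mulr_suml; apply: eq_bigr => p _.
    by rewrite mulr_suml.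
  have -> : \sum_p \sum_q c p * c q * phi p q =
      t * (L * (\sum_p c p) + (\sum_p c p) * L - F
           - (\sum_p c p) * (\sum_p c p) * g r r).
    rewrite cL Lc cc -big_split /= -!sumrB mulr_sumr; apply: eq_bigr => p _.
    rewrite -big_split /= -!sumrB mulr_sumr; apply: eq_bigr => q _.
    by rewrite /phi; ring.
  by rewrite mulr_ge0 //; move: H; rewrite /x; lra.
have phisym p q : phi p q = phi q p by rewrite /phi (gsym p q); ring.
(* The term [g r r] is shared equally between the two scaling factors. *)
pose f p := expR (- (t * (g r p - g r r / 2))).
apply: eq_psd (psd_scale f (psd_expR phisym phi0)) => p q.
by rewrite /f -!expRD; congr expR; rewrite /phi; field.
Qed.

(** * Matrix-valued kernels as scalar kernels on pairs (point, component) *)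

Lemma kernel_formE (R : realType) (d m : nat) (K : mxkernel R d m) n
    (x : 'I_n -> 'cV[R]_d) (a : 'I_n -> 'cV[R]_m) :
  kernel_form K x a =
  \sum_(p : 'I_n * 'I_m) \sum_(q : 'I_n * 'I_m)
    a p.1 p.2 0 * a q.1 q.2 0 * K (x p.1) (x q.1) p.2 q.2.
Proof.
rewrite /kernel_form -(pair_bigA _ (fun k i => \sum_(q : 'I_n * 'I_m)
    a k i 0 * a q.1 q.2 0 * K (x k) (x q.1) i q.2)) /=.
apply: eq_bigr => k _.
under [RHS]eq_bigr => i _ do
  rewrite -(pair_bigA _ (fun l j => a k i 0 * a l j 0 * K (x k) (x l) i j)) /=.
rewrite [RHS]exchange_big; apply: eq_bigr => l _ /=.
rewrite [RHS]exchange_big mxE; apply: eq_bigr => j _ /=.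
rewrite mxE mulr_suml; apply: eq_bigr => i _.
by rewrite mxE; ring.
Qed.

Lemma kernel_posdef_psd (R : realType) (d m : nat) (K : mxkernel R d m) :
  kernel_sym K ->
  (forall n (x : 'I_n -> 'cV[R]_d),
    psd (fun p q : 'I_n * 'I_m => K (x p.1) (x q.1) p.2 q.2)) ->
  kernel_posdef K.
Proof.
move=> Ksym K0; split=> // n x a; rewrite kernel_formE.
exact: (K0 n x (fun p => a p.1 p.2 0)).
Qed.

(** The constraint on the vectors [a k] is a single scalar equation, which for the flattened
    coefficients says exactly that they sum to zero, as Schoenberg's theorem requires. *)
Lemma kernel_cnegdef_sum (R : realType) (d m : nat) (K : mxkernel R d m) n
    (x : 'I_n -> 'cV[R]_d) (c : 'I_n * 'I_m -> R) :
  kernel_cnegdef K -> \sum_p c p = 0 ->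
  \sum_p \sum_q c p * c q * K (x p.1) (x q.1) p.2 q.2 <= 0.
Proof.
move=> [_ K0] c0; have := K0 n x (fun k => \col_i c (k, i)).
rewrite kernel_formE (_ : \sum_p \sum_q _ =
  \sum_p \sum_q c p * c q * K (x p.1) (x q.1) p.2 q.2); last first.
  by apply: eq_bigr => -[k i] _; apply: eq_bigr => -[l j] _; rewrite !mxE.
have c0' : \sum_i \sum_k c (k, i) = 0.
  by rewrite exchange_big pair_bigA -[RHS]c0; apply: eq_bigr => -[].
apply; apply/matrixP => i j; rewrite [LHS]mxE [RHS]mxE -[RHS]c0'.
apply: eq_bigr => l _; rewrite !mxE mul1r summxE.
by apply: eq_bigr => k _; rewrite mxE.
Qed.

(** * Positive definiteness of the mixture kernel *)

Theorem proposition5p2 (R : realType) (d m : nat)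
  (gamma : mxkernel R d m) (gamma_cnd : kernel_cnegdef gamma)
  (mu : {measure set (measurableTypeR R) -> \bar R})
  (Sigma : 'I_m -> 'cV[R]_d -> 'M[R]_d)
  (Sigma_pd : forall (i : 'I_m) (x : 'cV[R]_d), sym_posdef_mx (Sigma i x))
  (integral_exists : forall (x y : 'cV[R]_d) (i j : 'I_m),
    mu.-integrable `]0, +oo[ (EFin \o mixture_integrand gamma Sigma i j x y)) :
  kernel_posdef (mixture_kernel gamma Sigma mu).
Proof.
have gsym := gamma_cnd.1.
have avgC i j x y : Sigma_avg Sigma i j x y = Sigma_avg Sigma j i y x.
  by rewrite /Sigma_avg addrC.
have integrandC i j x y :
    mixture_integrand gamma Sigma i j x y = mixture_integrand gamma Sigma j i y x.
  apply/funext => t; rewrite /mixture_integrand avgC gsym -(opprB y x).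
  have -> : (- (y - x))^T = - (y - x)^T by rewrite linearN.
  by rewrite mulmxN !mulNmx opprK.
apply: kernel_posdef_psd => [x y i j|n x].
  rewrite /mixture_kernel [LHS]mxE [RHS]mxE avgC integrandC.
  by rewrite [\det (Sigma i x) `^ _ * _]mulrC.
set T := ('I_n * 'I_m)%type.
pose g (p q : T) := gamma (x p.1) (x q.1) p.2 q.2.
pose w (p q : T) := \det (Sigma p.2 (x p.1)) `^ (1 / 4) *
  \det (Sigma q.2 (x q.1)) `^ (1 / 4) /
  \det (Sigma_avg Sigma p.2 q.2 (x p.1) (x q.1)) `^ (1 / 2).
(* The prefactor [w] does not depend on [t] and moves under the integral. *)
pose K t p q :=
  w p q * mixture_integrand gamma Sigma p.2 q.2 (x p.1) (x q.1) t.
have mD : measurable (`]0, +oo[ : set (measurableTypeR R)) by [].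
apply: (@eq_psd _ _ (fun p q => \int[mu]_(t in `]0, +oo[) K t p q)).
  by move=> p q; rewrite RintegralZl // mxE.
apply: psd_Rintegral => // [p q|t /=].
  by apply: eq_integrable (integrableZl mD (w p q) (integral_exists _ _ _ _)).
rewrite in_itv /= andbT => t0.
(* Scaling the points by [sqrt t] puts the factor [t] on the quadratic form and leaves the
   determinants unchanged. *)
have S0 := psd_spatial (fun p : T => Num.sqrt t *: x p.1)
  (fun p : T => Sigma_pd p.2 (x p.1)).
have E0 : psd (fun p q => expR (- (t * g p q))).
  apply: schoenberg => [p q|c c0|]; last exact: ltW.
    exact: gsym.
  exact: kernel_cnegdef_sum gamma_cnd c0.
apply: eq_psd (psd_mul _ E0 S0) => p q; last by rewrite /g gsym.
rewrite /K /w /mixture_integrand -/(Sigma_avg _ _ _ _ _) mulrCA; congr (_ * _).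
rewrite -expRD; congr expR; rewrite -scalerBr.
rewrite quad_formZ sqr_sqrtr ?(ltW t0) //.
by rewrite -opprD -mulrDr addrC.
Qed.
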